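(* Let $R=R_1\times R_2\times\cdots\times R_s$ with $s\ge 2$, where each $R_i$ is a finite local ring with maximal ideal $M_i$ of order $m_i$, and where $|R_1|/m_1\le |R_2|/m_2\le\cdots\le |R_s|/m_s$. Then the complement $\overline{G}_R$ of the unitary Cayley graph $G_R$ is Ramanujan if and only if $R$ satisfies one of the following conditions: (a) $|R_i|/m_i=2$ for $1\le i\le s$, and $\prod_{i=1}^s m_i\le 2^{s+1}-3+2\sqrt{2^s(2^s-3)}$; (b) $2=|R_1|/m_1=\cdots=|R_t|/m_t<|R_{t+1}|/m_{t+1}$ for some $t$ with $2\le t<s$, and $|R^\times|\le 2\sqrt{|R|}-3$; (c) $2=|R_1|/m_1<|R_2|/m_2$ and $|R^\times|\le 2\sqrt{|R|-2}-1$; (d) $3\le |R_1|/m_1$ and $$\frac{|R^\times|}{(|R_1|/m_1)-1}\le -\left(2(|R_1|/m_1)-3\right)+\sqrt{\left(2(|R_1|/m_1)-3\right)^2+(4|R|-9)}.$$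
   Context: Rings are commutative with identity $1\neq 0$. For a finite commutative ring $R$, $R^\times$ denotes its group of units. The unitary Cayley graph $G_R$ is the graph with vertex set $R$ in which $x,y\in R$ are adjacent if and only if $x-y\in R^\times$. Its complement $\overline{G}_R$ has the same vertex set, with two distinct vertices adjacent iff they are not adjacent in $G_R$; it is $(|R|-1-|R^\times|)$-regular. A local ring is a commutative ring with a unique maximal ideal. The eigenvalues of a graph are those of its adjacency matrix. A finite $r$-regular graph is Ramanujan if every eigenvalue $\lambda$ with $\lambda\neq\pm r$ satisfies $|\lambda|\le 2\sqrt{r-1}$. *)

(* Defs.v *)
From HB Require Import structures.
From mathcomp Require Import all_boot all_order all_algebra.
From mathcomp Require Import reals.

Set Implicit Arguments.
Unset Strict Implicit.
Unset Printing Implicit Defensive.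

Import Order.TTheory GRing.Theory Num.Theory.
Local Open Scope ring_scope.

Section ProductRing.
Variables (n : nat) (R : 'I_n.+1 -> finComUnitRingType).

(* There are n.+1 factors, so that the product is a nonzero ring. *)
Definition prodring := {dffun forall i, R i}.

HB.instance Definition _ := Finite.on prodring.

Implicit Types x y z : prodring.

Definition prodring0 : prodring := [ffun i => 0 : R i].
Definition prodring1 : prodring := [ffun i => 1 : R i].
Definition prodring_opp x : prodring := [ffun i => - x i].
Definition prodring_add x y : prodring := [ffun i => x i + y i].
Definition prodring_mul x y : prodring := [ffun i => x i * y i].

Fact prodring_addA : associative prodring_add.
Proof. by move=> x y z; apply/ffunP => i; rewrite !ffunE addrA. Qed.
Fact prodring_addC : commutative prodring_add.
Proof. by move=> x y; apply/ffunP => i; rewrite !ffunE addrC. Qed.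
Fact prodring_add0 : left_id prodring0 prodring_add.
Proof. by move=> x; apply/ffunP => i; rewrite !ffunE add0r. Qed.
Fact prodring_addN : left_inverse prodring0 prodring_opp prodring_add.
Proof. by move=> x; apply/ffunP => i; rewrite !ffunE addNr. Qed.

HB.instance Definition _ := GRing.isZmodule.Build prodring
  prodring_addA prodring_addC prodring_add0 prodring_addN.

Fact prodring_mulA : associative prodring_mul.
Proof. by move=> x y z; apply/ffunP => i; rewrite !ffunE mulrA. Qed.
Fact prodring_mulC : commutative prodring_mul.
Proof. by move=> x y; apply/ffunP => i; rewrite !ffunE mulrC. Qed.
Fact prodring_mul1 : left_id prodring1 prodring_mul.
Proof. by move=> x; apply/ffunP => i; rewrite !ffunE mul1r. Qed.
Fact prodring_mulD : left_distributive prodring_mul prodring_add.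
Proof. by move=> x y z; apply/ffunP => i; rewrite !ffunE mulrDl. Qed.
Fact prodring1_neq0 : prodring1 != prodring0.
Proof. by apply/eqP => /ffunP /(_ ord0) /eqP; rewrite !ffunE oner_eq0. Qed.

HB.instance Definition _ := GRing.Zmodule_isComNzRing.Build prodring
  prodring_mulA prodring_mulC prodring_mul1 prodring_mulD prodring1_neq0.

Definition prodring_unit : {pred prodring} :=
  [pred x : prodring | [forall i, x i \is a GRing.unit]].
Definition prodring_inv x : prodring :=
  if x \in prodring_unit then [ffun i => (x i)^-1] else x.

Fact prodring_mulV :
  {in prodring_unit, left_inverse 1 prodring_inv *%R}.
Proof.
move=> x ux; rewrite /prodring_inv ux; apply/ffunP => i.
by rewrite !ffunE mulVr //; exact: (forallP ux).
Qed.
Fact prodring_unitP x y : y * x = 1 -> prodring_unit x.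
Proof.
move=> /ffunP yx; apply/forallP => i; apply/unitrPr; exists (y i).
by have := yx i; rewrite !ffunE mulrC.
Qed.
Fact prodring_inv_out : {in [predC prodring_unit], prodring_inv =1 id}.
Proof. by move=> x /negPf nux; rewrite /prodring_inv nux. Qed.

HB.instance Definition _ := GRing.ComNzRing_hasMulInverse.Build prodring
  prodring_mulV prodring_unitP prodring_inv_out.

End ProductRing.

Section LocalRing.
Variable R : finComUnitRingType.
Implicit Types M J : {set R}.

(* [idealr_closed] includes properness: it requires 1 \notin M. *)
Definition maximal_ideal M : Prop :=
  idealr_closed M /\
  forall J, idealr_closed J -> M \subset J -> J = M.

Definition local_ring_with M : Prop :=
  maximal_ideal M /\ forall J, maximal_ideal J -> J = M.

(* |R| / |M|; the division is exact when M is an ideal. *)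
Definition residue_card M : nat := #|R| %/ #|M|.

Definition nb_units : nat := #|[set x : R | x \is a GRing.unit]|.

Definition unitary_cayley : rel R := fun x y => x - y \is a GRing.unit.

End LocalRing.

Arguments nb_units : clear implicits.
Arguments unitary_cayley : clear implicits.

Section Graphs.
Variable T : finType.
Implicit Type e : rel T.

Definition complement_graph e : rel T := fun x y => (x != y) && ~~ e x y.

Definition regular_graph e (r : nat) : Prop :=
  forall x, #|[set y | e x y]| = r.

Definition adjacency (K : realType) e : 'M[K]_#|T| :=
  \matrix_(i, j) (e (enum_val i) (enum_val j))%:R.

(* All eigenvalues are in K, as the adjacency matrix of an undirected graph is
   symmetric. *)
Definition ramanujan (K : realType) e : Prop :=
  exists2 r : nat, regular_graph e r &
    forall l : K, eigenvalue (adjacency K e) l ->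
      l != r%:R -> l != - r%:R -> `|l| <= 2 * Num.sqrt (r%:R - 1).

End Graphs.

(* Main.v *)
Require Import Defs.
From mathcomp Require Import all_boot all_order all_algebra all_fingroup.
From mathcomp Require Import reals.
From mathcomp Require Import lra zify ring.
Import Order.TTheory GRing.Theory Num.Theory.
Set Implicit Arguments.
Unset Strict Implicit.
Unset Printing Implicit Defensive.
Local Open Scope ring_scope.

(* The adjacency operator of the unitary Cayley graph is the composition, over
   the factors, of the sums over R_i minus M_i, i.e. of the differences between
   the sum over R_i and the sum over M_i. Up to scalars these sums are commuting
   idempotents, so every eigenvector can be refined to a common one, and the
   eigenvalues are the products of mu_i in {0, -m_i, m_i (q_i - 1)}. On vectors
   of sum zero the complement acts as -1 minus this operator, and there not
   every mu_i equals m_i (q_i - 1). The extremal eigenvalue takes mu_i = -m_i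
   at exactly two indices with q_i = 2 if there are two such indices, and at
   the first index only otherwise; it is then compared with the Ramanujan
   bound. *)

(** * Sums over translates in a finite abelian group *)

Section ShiftSums.
Variables (K : numFieldType) (V : finZmodType).
Implicit Types (D H T : {set V}) (c : K) (g : V -> K).

(** The adjacency operator of the Cayley graph with connection set [D], acting on functions instead
    of row vectors. *)
Definition shift_sum D g (x : V) : K := \sum_(h in D) g (x + h).

Definition shift_eigen D c g := forall x, shift_sum D g x = c * g x.

Definition translation_stable H D :=
  forall z y, z \in H -> (y + z \in D) = (y \in D).

Lemma shift_sumC D D' g x :
  shift_sum D (shift_sum D' g) x = shift_sum D' (shift_sum D g) x.
Proof.
rewrite /shift_sum exchange_big; apply: eq_bigr => h _.
by apply: eq_bigr => h' _; rewrite addrAC.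
Qed.

Lemma shift_eigen_sum D c D' g :
  shift_eigen D c g -> shift_eigen D c (shift_sum D' g).
Proof.
move=> Dg x; rewrite shift_sumC /shift_sum mulr_sumr.
by apply: eq_bigr => h _; rewrite -Dg.
Qed.

(** Translating by an element of [H] permutes [D], so [shift_sum D g] is [H]-invariant and summing
    it over [H] multiplies it by the order of [H]. *)
Lemma shift_eigen_stable H D g : translation_stable H D ->
  shift_eigen H #|H|%:R (shift_sum D g).
Proof.
move=> HD x; rewrite {1}/shift_sum.
rewrite (eq_bigr (fun=> shift_sum D g x)) ?sumr_const ?mulr_natl // => z Hz.
rewrite [RHS](reindex_inj (addIr z)) /=.
apply: eq_big => y; first by rewrite HD.
by move=> _; rewrite -addrA (addrC y).
Qed.

Lemma shift_eigenD D H c d g : H \subset D ->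
  shift_eigen D c g -> shift_eigen H d g -> shift_eigen (D :\: H) (c - d) g.
Proof.
move=> HD Dg Hg x; rewrite mulrBl -Dg -Hg {2}/shift_sum (big_setID H) /=.
by rewrite (setIidPr HD) addrC addrK.
Qed.

Lemma shift_eigen_cst D : shift_eigen D #|D|%:R (fun=> 1).
Proof. by move=> x; rewrite /shift_sum sumr_const mulr1. Qed.

Lemma shift_eigen_uniq D c d g :
  (exists x, g x != 0) -> shift_eigen D c g -> shift_eigen D d g -> c = d.
Proof.
by case=> x gx Dc Dd; apply: (mulIf gx); rewrite -Dc -Dd.
Qed.

(** With [H] and [T] the copies of M_i and R_i in the product, the difference of the eigenvalues for
    [T] and [H] is 0, -m_i and m_i (q_i - 1) respectively. *)
Definition shift_type H T g : Prop :=
  [\/ shift_eigen H 0 g /\ shift_eigen T 0 g,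
      shift_eigen H #|H|%:R g /\ shift_eigen T 0 g
    | shift_eigen H #|H|%:R g /\ shift_eigen T #|T|%:R g].

(* The sums over H and over T are, up to scalars, commuting idempotents with
   the second below the first; applying them to g keeps the eigenequations. *)
Lemma shift_type_refine H T g : (0 < #|H|)%N ->
  translation_stable H H -> translation_stable H T -> translation_stable T T ->
  (exists x, g x != 0) ->
  exists2 g', (exists x, g' x != 0) & shift_type H T g' /\
    forall D c, shift_eigen D c g -> shift_eigen D c g'.
Proof.
move=> H0 HH HT TT gN0.
have zeroP f : (exists x, f x != 0) \/ (forall x : V, f x = 0 :> K).
  case: (boolP [exists x, f x != 0]) => [/existsP|/existsPn f0]; first by left.
  by right=> x; apply/eqP; have := f0 x; rewrite negbK.
case: (zeroP (shift_sum H g)) => [HgN0|Hg0].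
  case: (zeroP (shift_sum T (shift_sum H g))) => [TN0|T0].
    exists (shift_sum T (shift_sum H g)) => //; split.
      by apply: Or33; split; apply: shift_eigen_stable.
    by move=> D c gD; do 2!apply: shift_eigen_sum.
  exists (shift_sum H g) => //; split; last by move=> D c /shift_eigen_sum.
  by apply: Or32; split; [apply: shift_eigen_stable|move=> x; rewrite T0 mul0r].
exists g => //; split=> //; apply: Or31; split=> x; rewrite mul0r //.
(* As [T] is [H]-stable, the order of [H] times the sum over [T] equals the sum over [T] of the sum
   over [H], which vanishes here. *)
apply: (@mulfI _ #|H|%:R); first by rewrite pnatr_eq0 -lt0n.
rewrite -(shift_eigen_stable g HT) shift_sumC mulr0.
by apply: big1 => h _; rewrite Hg0.
Qed.

End ShiftSums.

(** * Sums over boxes in a product ring *)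

Section ProductShiftSums.
Variables (K : numFieldType) (n : nat) (R_ : 'I_n.+1 -> finComUnitRingType).
Local Notation R := (prodring R_).
Implicit Types (i j : 'I_n.+1) (x y : R) (g : R -> K).

Definition prod_inj i (z : R_ i) : R := 
  [ffun j => @dfwith _ (fun j => R_ j : Type) (fun j => 0 : R_ j) i z j].

Lemma prod_inj_in i (z : R_ i) : prod_inj z i = z.
Proof. by rewrite ffunE dfwith_in. Qed.

Lemma prod_inj_out i (z : R_ i) j : i != j -> prod_inj z j = 0.
Proof. by move=> ij; rewrite ffunE dfwith_out. Qed.

Lemma prod_inj_inj i : injective (@prod_inj i).
Proof. by move=> z z' /(congr1 (fun x : R => x i)); rewrite !prod_inj_in. Qed.

Lemma prod_addE x y i : (x + y) i = x i + y i.
Proof. by rewrite ffunE. Qed.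

Definition box (D : forall i, {set R_ i}) : {set R} :=
  [set x : R | [forall i, x i \in D i]].

(** The sum over a box is the composition of the sums over its sides, each embedded along its own
    coordinate. *)
Lemma shift_eigen_box (D : forall i, {set R_ i}) (c : 'I_n.+1 -> K) g :
  (forall i, shift_eigen (@prod_inj i @: D i) (c i) g) ->
  shift_eigen (box D) (\prod_i c i) g.
Proof.
move=> Dg.
(* Induction on the number of free coordinates: in [B k] those from [k] on are frozen at 0. *)
pose B k := [set x : R |
  [forall i : 'I_n.+1, if (i < k)%N then x i \in D i else x i == 0]].
have -> : box D = B n.+1.
  by apply/setP => x; rewrite !inE; apply: eq_forallb => i; rewrite ltn_ord.
suff Bk k : (k <= n.+1)%N ->
    shift_eigen (B k) (\prod_(i < n.+1 | (i < k)%N) c i) g.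
  move=> x; rewrite Bk //; congr (_ * _); apply: eq_bigl => i.
  exact: ltn_ord.
elim: k => [_|k IHk kn] x.
  rewrite big_pred0 // mul1r /shift_sum (big_pred1 0) ?addr0 // => h.
  rewrite !inE; apply/forallP/eqP => [h0|-> i]; last by rewrite /= ffunE.
  by apply/ffunP => i; rewrite (eqP (h0 i)) ffunE.
pose k' := Ordinal kn.
have -> : \prod_(i < n.+1 | (i < k.+1)%N) c i =
    c k' * \prod_(i < n.+1 | (i < k)%N) c i.
  rewrite (bigD1 k') //=; congr (_ * _); apply: eq_bigl => i.
  by rewrite ltnS [RHS]ltn_neqAle andbC.
rewrite mulrAC -mulrA [g x * _]mulrC -(IHk (ltnW kn)).
rewrite [in RHS]/shift_sum mulr_sumr.
have DkE y : c k' * g y = \sum_(z in D k') g (y + prod_inj z).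
  by rewrite -(Dg k') /shift_sum big_imset // => ? ? _ _; apply: prod_inj_inj.
under [RHS]eq_bigr => h _ do rewrite DkE.
rewrite pair_big /= /shift_sum.
(* Each element of [B k.+1] splits uniquely into an element of [B k] and its coordinate at [k']. *)
rewrite (reindex_onto (fun p : R * R_ k' => p.1 + prod_inj p.2)
          (fun h : R => (h - prod_inj (h k'), h k'))) /=; last first.
  by move=> h _; rewrite subrK.
apply: eq_big => [[h z]|[h z] _] /=; last by rewrite addrA.
rewrite !inE xpair_eqE prod_addE prod_inj_in.
apply/andP/andP => [[/forallP hB /andP[/eqP _ /eqP hz]]|[/forallP hB zD]].
  have hk : h k' = 0 by apply: (addIr z); rewrite hz add0r.
  split; last by have := hB k'; rewrite ltnSn prod_addE prod_inj_in hz.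
  apply/forallP => i; have := hB i; rewrite prod_addE ltnS.
  have [<-|ik] := eqVneq k' i; first by rewrite ltnn hk eqxx.
  rewrite prod_inj_out // addr0 leq_eqVlt.
  by rewrite -[k]/(val k') val_eqE [i == k']eq_sym (negPf ik).
have hk : h k' = 0 by have := hB k'; rewrite ltnn => /eqP.
rewrite hk add0r addrK !eqxx; split=> //; apply/forallP => i.
rewrite prod_addE ltnS; have := hB i.
have [<-|ik] := eqVneq k' i; first by rewrite ltnn leqnn prod_inj_in hk add0r.
rewrite prod_inj_out // addr0 [(i <= k)%N]leq_eqVlt.
by rewrite -[k]/(val k') val_eqE [i == k']eq_sym (negPf ik).
Qed.

Lemma translation_stable_inj i (H D : {set R_ i}) :
  translation_stable H D ->
  translation_stable (@prod_inj i @: H) (@prod_inj i @: D).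
Proof.
move=> HD _ y /imsetP[z Hz ->]; apply/imsetP/imsetP => -[d Dd].
  move=> yz; exists (d - z); first by rewrite -(HD z) // subrK.
  apply: (addIr (prod_inj z)); rewrite yz; apply/ffunP => j.
  rewrite prod_addE; have [<-|ij] := eqVneq i j.
    by rewrite !prod_inj_in subrK.
  by rewrite !prod_inj_out // addr0.
move=> ->; exists (d + z); first by rewrite HD.
apply/ffunP => j; rewrite prod_addE; have [<-|ij] := eqVneq i j.
  by rewrite !prod_inj_in.
by rewrite !prod_inj_out // addr0.
Qed.

End ProductShiftSums.

(** Both sides are eigenvalues of the sum over [box D] on the constant function 1. *)
Lemma card_box (n : nat) (R_ : 'I_n.+1 -> finComUnitRingType)
    (D : forall i, {set R_ i}) : #|box D| = (\prod_i #|D i|)%N.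
Proof.
apply/eqP; rewrite -(eqr_nat rat) natr_prod; apply/eqP.
apply: (@shift_eigen_uniq rat (prodring R_) (box D) _ _ (fun=> 1)).
- by exists 0; rewrite oner_eq0.
- exact: shift_eigen_cst.
apply: shift_eigen_box => i; rewrite -(card_imset _ (@prod_inj_inj _ _ i)).
exact: shift_eigen_cst.
Qed.

(** * Units and residue cardinalities of finite local rings *)

Section LocalRings.
Variable R : finComUnitRingType.
Implicit Types (M J : {set R}) (x : R).

Lemma ideal_nonunit M x : idealr_closed M -> x \in M -> x \isn't a GRing.unit.
Proof.
case=> M0 M1 Mcl xM; apply: contra M1 => ux.
by have := Mcl x^-1 x 0 xM M0; rewrite mulVr // addr0.
Qed.

(** The multiples of a nonunit form a proper ideal, and by finiteness some inclusion-maximal proper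
    ideal contains it. *)
Lemma nonunit_maximal_ideal x :
  x \isn't a GRing.unit -> exists2 M, maximal_ideal M & x \in M.
Proof.
move=> nux.
(* A boolean form of [idealr_closed], as [maxset] requires. *)
pose P J := [&& 0 \in J, 1 \notin J &
  [forall a, forall u in J, forall v in J, a * u + v \in J]].
have PP J : reflect (idealr_closed J) (P J).
  apply: (iffP and3P) => -[J0 J1 Jcl]; split=> //.
    move=> a u v uJ vJ.
    by have /forall_inP/(_ u uJ)/forall_inP/(_ v vJ) := forallP Jcl a.
  apply/forallP => a; apply/forall_inP => u uJ; apply/forall_inP => v vJ.
  exact: Jcl.
have xR : P [set x * y | y : R].
  apply/PP; split.
  - by apply/imsetP; exists 0; rewrite ?mulr0.
  - apply: contra nux => /imsetP[y _ xy]; apply/unitrPr.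
    by exists y.
  move=> a _ _ /imsetP[y _ ->] /imsetP[z _ ->]; apply/imsetP.
  by exists (a * y + z); rewrite // mulrDr mulrCA.
have [M /maxsetP[PM Mmax] xM] := maxset_exists xR.
exists M; last by apply: (subsetP xM); apply/imsetP; exists 1; rewrite ?mulr1.
by split; [apply/PP|move=> J /PP PJ MJ; apply: Mmax].
Qed.

Lemma local_ring_mem M x : local_ring_with M ->
  (x \in M) = (x \isn't a GRing.unit).
Proof.
case=> -[Mid _] Muniq; apply/idP/idP; first exact: ideal_nonunit.
by move=> /nonunit_maximal_ideal[J /Muniq ->].
Qed.

Lemma ideal_translation_stable M : idealr_closed M -> translation_stable M M.
Proof.
move=> [M0 M1 Mcl] z y zM; apply/idP/idP => yM; last first.
  by rewrite -[y]mul1r; apply: Mcl.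
by have := Mcl (-1) z (y + z) zM yM; rewrite mulN1r [y + z]addrC addKr.
Qed.

(** Lagrange's theorem in the additive group of [R]. *)
Lemma ideal_card_dvd M : idealr_closed M -> (#|M| %| #|R|)%N.
Proof.
move=> [M0 M1 Mcl].
have gM : group_set (M : {set R}).
  apply/group_setP; split=> // x y xM yM.
  by have := Mcl 1 x y xM yM; rewrite mul1r.
by have := cardSg (subsetT (Group gM)); rewrite cardsT.
Qed.

Lemma residue_cardM M : idealr_closed M -> #|R| = (#|M| * residue_card M)%N.
Proof. by move=> /ideal_card_dvd MR; rewrite mulnC divnK. Qed.

Lemma residue_card_gt1 M : idealr_closed M -> (1 < residue_card M)%N.
Proof.
move=> Mid; have [M0 M1 _] := Mid; have RE := residue_cardM Mid.
have : (#|M| < #|R|)%N.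
  rewrite -cardsT; apply: proper_card; rewrite properT.
  by apply: contraNneq M1 => ->; rewrite inE.
by rewrite RE -{1}[#|M|]muln1 ltn_mul2l => /andP[].
Qed.

End LocalRings.

(** * Spectrum of the complement of a unitary Cayley graph *)

Section AdjacencyEigenvalues.
Variable K : realType.

(** Replaces row vectors indexed by ordinals with functions on the vertices; eigenvectors act on the
    left, so the sum runs over the first argument of [e]. *)
Lemma eigenvalue_adjacencyP (T : finType) (e : rel T) (l : K) :
  eigenvalue (adjacency K e) l <->
  exists2 g : T -> K, exists x, g x != 0 &
    forall y, \sum_x g x * (e x y)%:R = l * g y.
Proof.
split.
  case/eigenvalueP => v vA v0; exists (fun x => v 0 (enum_rank x)).
    have [i vi] : exists i, v 0 i != 0.
      apply/existsP; rewrite -negb_forall; apply: contra v0 => /forallP v0.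
      by apply/eqP/rowP => i; rewrite mxE; apply/eqP.
    by exists (enum_val i); rewrite enum_valK.
  move=> y; have := congr1 (fun w : 'rV_#|T| => w 0 (enum_rank y)) vA.
  rewrite !mxE => <-; rewrite (reindex _ (onW_bij _ (@enum_val_bij T))) /=.
  apply: eq_bigr => i _.
  by rewrite mxE enum_valK enum_rankK.
case=> g [x gx] gA; apply/eigenvalueP.
exists (\row_i g (enum_val i)).
  apply/rowP => j; rewrite !mxE -gA.
  rewrite (reindex _ (onW_bij _ (@enum_val_bij T))) /=.
  apply: eq_bigr => i _.
  by rewrite !mxE.
apply: contraNneq gx => /rowP/(_ (enum_rank x)).
by rewrite !mxE enum_rankK => ->.
Qed.

Variable R : finComUnitRingType.
Local Notation U := [set x : R | x \is a GRing.unit].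
Local Notation e := (complement_graph (unitary_cayley R)).

(** This is the matrix identity J - I - A, with J the all-one matrix and A the adjacency matrix of
    the unitary Cayley graph. *)
Lemma complement_adjacency (g : R -> K) y :
  \sum_x g x * (e x y)%:R = \sum_x g x - g y - shift_sum U g y.
Proof.
have -> : shift_sum U g y = \sum_(x | x - y \is a GRing.unit) g x.
  rewrite /shift_sum [RHS](reindex_inj (addrI y)) /=; apply: eq_bigl => h.
  by rewrite inE addrC addKr.
have -> : g y = \sum_(x | x == y) g x by rewrite big_pred1_eq.
rewrite -addrA -opprD; apply: (canRL (addrK _)).
rewrite [X in _ + (X + _)]big_mkcond [X in _ + (_ + X)]big_mkcond -!big_split.
apply: eq_bigr => x _; rewrite /complement_graph /unitary_cayley /=.
have [->|xy] := eqVneq x y; first by rewrite subrr unitr0 mulr0 addr0 add0r.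
by case: ifP => _; rewrite /= ?mulr1 ?mulr0 ?add0r ?addr0.
Qed.

(** The map sending y to x - y is a bijection from the neighbours of x to the nonzero nonunits. *)
Lemma complement_regular : regular_graph e (#|R| - 1 - nb_units R).
Proof.
move=> x; pose h (y : R) := x - y.
have hI : injective h by move=> y z /addrI/oppr_inj.
rewrite -(card_imset _ hI).
have -> : h @: [set y | e x y] = ~: (0 |: U).
  apply/setP => z; rewrite !inE; apply/imsetP/idP => [[y]|].
    rewrite inE /complement_graph /unitary_cayley => /andP[xy nu] ->.
    by rewrite /h subr_eq0 negb_or xy.
  rewrite negb_or => /andP[z0 nu]; exists (x - z); last by rewrite /h subKr.
  rewrite inE /complement_graph /unitary_cayley subKr nu andbT.
  by rewrite eq_sym -subr_eq0 addrAC subrr add0r oppr_eq0.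
by rewrite cardsCs setCK cardsU1 inE unitr0 subnDA.
Qed.

Lemma regular_graph_uniq (T : finType) (f : rel T) (x : T) r r' :
  regular_graph f r -> regular_graph f r' -> r = r'.
Proof. by move=> /(_ x) <- /(_ x). Qed.

(* An eigenvector with nonzero sum belongs to the degree, since the all-one
   vector is a left eigenvector. *)
Lemma complement_eigenvalue (l : K) : eigenvalue (adjacency K e) l ->
  l = #|R|%:R - 1 - (nb_units R)%:R \/
  exists2 g : R -> K, exists x, g x != 0 &
    shift_eigen setT 0 g /\ shift_eigen U (-1 - l) g.
Proof.
move/eigenvalue_adjacencyP => [g gN0 gl].
have {}gl y : \sum_x g x - g y - shift_sum U g y = l * g y.
  by rewrite -complement_adjacency.
have [S0|SN0] := eqVneq (\sum_x g x) 0.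
  right; exists g => //; split=> x; last first.
    by have := gl x; rewrite S0; lra.
  rewrite mul0r -[RHS]S0 [RHS](reindex_inj (addrI x)) /=.
  by apply: eq_bigl => h; rewrite inE.
left; apply: (mulIf SN0); rewrite mulr_sumr.
under eq_bigr => y _ do rewrite -gl.
rewrite !sumrB sumr_const /shift_sum exchange_big /=.
rewrite [X in _ - _ - X](eq_bigr (fun=> \sum_x g x)); last first.
  by move=> h _; rewrite [RHS](reindex_inj (addIr h)).
by rewrite sumr_const !mulrBl mul1r !mulr_natl.
Qed.

Lemma complement_eigenvalue_intro (g : R -> K) c : (exists x, g x != 0) ->
  shift_eigen setT 0 g -> shift_eigen U c g ->
  eigenvalue (adjacency K e) (-1 - c).
Proof.
move=> gN0 gT gU; apply/eigenvalue_adjacencyP; exists g => // y.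
rewrite complement_adjacency gU; have := gT 0; rewrite mul0r /shift_sum.
under eq_bigr => h _ do rewrite add0r.
by rewrite (eq_bigl xpredT) => [->|h]; [ring|rewrite inE].
Qed.

End AdjacencyEigenvalues.

(** * Eigenvalues for a product of local rings *)

Section ProductOfLocalRings.
Variables (K : realType) (n : nat) (R_ : 'I_n.+1 -> finComUnitRingType).
Variables (M : forall i, {set R_ i}).
Hypothesis M_local : forall i, local_ring_with (M i).
Local Notation R := (prodring R_).
Local Notation U := [set x : R | x \is a GRing.unit].
Local Notation e := (complement_graph (unitary_cayley R)).
Local Notation H i := (@prod_inj n R_ i @: M i).
Local Notation T i := (@prod_inj n R_ i @: [set: R_ i]).
Local Notation m i := #|M i|.
Local Notation b i := (residue_card (M i)).-1.
Local Notation w i := (#|M i| * (residue_card (M i)).-1)%N.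

Lemma factor_ideal i : idealr_closed (M i).
Proof. by case: (M_local i) => -[]. Qed.

Lemma card_factor_ideal_gt0 i : (0 < m i)%N.
Proof. by case: (factor_ideal i) => M0 _ _; apply/card_gt0P; exists 0. Qed.

Lemma residue_pred_gt0 i : (0 < b i)%N.
Proof.
by have := residue_card_gt1 (factor_ideal i); case: residue_card => // -[].
Qed.

Lemma card_factor i : #|R_ i| = (m i + w i)%N.
Proof.
rewrite (residue_cardM (factor_ideal i)).
have := residue_card_gt1 (factor_ideal i).
by case: residue_card => // k _; rewrite mulnS.
Qed.

Lemma units_box : U = box (fun i => [set: R_ i] :\: M i).
Proof.
apply/setP => x; rewrite !inE; apply: eq_forallb => i.
by rewrite !inE andbT (local_ring_mem _ (M_local i)) negbK.
Qed.

Lemma setT_box : [set: R] = box (fun i => [set: R_ i]).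
Proof.
by apply/setP => x; rewrite !inE; apply/esym/forallP => i; rewrite inE.
Qed.

Lemma nb_units_prod : nb_units R = (\prod_i w i)%N.
Proof.
rewrite /nb_units units_box card_box; apply: eq_bigr => i _.
by rewrite cardsD setTI cardsT card_factor addKn.
Qed.

Lemma card_prodring : #|R| = (\prod_i (m i + w i))%N.
Proof.
rewrite -cardsT setT_box card_box; apply: eq_bigr => i _.
by rewrite cardsT card_factor.
Qed.

Lemma shift_eigen_units (c : 'I_n.+1 -> K) (d : 'I_n.+1 -> K) g :
  (forall i, shift_eigen (T i) (c i) g) ->
  (forall i, shift_eigen (H i) (d i) g) ->
  shift_eigen U (\prod_i (c i - d i)) g.
Proof.
move=> cg dg; rewrite units_box; apply: shift_eigen_box => i.
have -> : @prod_inj n R_ i @: (setT :\: M i) = T i :\: H i.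
  apply/setP => x; rewrite !inE; apply/imsetP/andP => [[z]|[xM]].
    rewrite !inE andbT => zM ->; split; last by apply: imset_f; rewrite inE.
    by rewrite mem_imset //; apply: prod_inj_inj.
  case/imsetP => z _ xz; exists z => //; rewrite !inE andbT.
  by apply: contra xM => zM; rewrite xz imset_f.
by apply: shift_eigenD => //; apply: imsetS; apply: subsetT.
Qed.

(** The indices are treated one at a time; each refinement keeps all eigenequations, hence also the
    types already obtained. *)
Lemma shift_type_all (g : R -> K) : (exists x, g x != 0) ->
  exists2 g' : R -> K, (exists x, g' x != 0) &
    (forall i, shift_type (H i) (T i) g') /\
    forall D c, shift_eigen D c g -> shift_eigen D c g'.
Proof.
move=> gN0; suff upto k : (k <= n.+1)%N ->
    exists2 g' : R -> K, (exists x, g' x != 0) &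
      (forall i : 'I_n.+1, (i < k)%N -> shift_type (H i) (T i) g') /\
      forall D c, shift_eigen D c g -> shift_eigen D c g'.
  have [g' g'N0 [g't g'D]] := upto n.+1 (leqnn _).
  by exists g' => //; split=> // i; apply: g't; apply: ltn_ord.
elim: k => [_|k IHk kn]; first by exists g.
have [g' g'N0 [g't g'D]] := IHk (ltnW kn).
pose k' := Ordinal kn.
have TT : translation_stable [set: R_ k'] [set: R_ k'].
  by move=> z y _; rewrite !inE.
have MT : translation_stable (M k') [set: R_ k'].
  by move=> z y _; rewrite !inE.
have [||||g1 g1N0 [g1t g1D]] :=
  @shift_type_refine K R (H k') (T k') g' _ _ _ _ g'N0.
- by rewrite card_imset ?card_factor_ideal_gt0 //; apply: prod_inj_inj.
- apply: translation_stable_inj.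
  exact: ideal_translation_stable (factor_ideal _).
- exact: translation_stable_inj.
- exact: translation_stable_inj.
exists g1 => //; split; last by move=> D c /g'D/g1D.
move=> i; rewrite ltnS leq_eqVlt => /orP[/eqP ik|/g't].
  by have -> : i = k' by apply: val_inj.
by case=> -[/g1D ? /g1D ?]; [apply: Or31|apply: Or32|apply: Or33].
Qed.

Lemma unit_eigen_list (g : R -> K) c : (exists x, g x != 0) ->
  shift_eigen setT 0 g -> shift_eigen U c g ->
  exists mu : 'I_n.+1 -> K,
    [/\ c = \prod_i mu i,
        forall i, [\/ mu i = 0, mu i = - (m i)%:R | mu i = (w i)%:R]
      & exists i, mu i != (w i)%:R].
Proof.
move=> gN0 gT gU; have [f fN0 [ft fD]] := shift_type_all gN0.
have cardH i : #|H i| = m i by rewrite card_imset //; apply: prod_inj_inj.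
have cardT i : #|T i| = (m i + w i)%N.
  by rewrite card_imset ?cardsT ?card_factor //; apply: prod_inj_inj.
(* [p i] pairs the eigenvalues of [f] for R_i and M_i. The last clause holds because only the third
   type yields the difference [w i], both numbers [m i] and [w i] being positive. *)
have /fin_all_exists[p pP] : forall i, exists p : K * K,
    [/\ shift_eigen (T i) p.1 f, shift_eigen (H i) p.2 f,
        [\/ p.1 - p.2 = 0, p.1 - p.2 = - (m i)%:R | p.1 - p.2 = (w i)%:R]
      & p.1 - p.2 = (w i)%:R -> p.1 = #|T i|%:R].
  move=> i; have mpos := card_factor_ideal_gt0 i.
  have bpos := residue_pred_gt0 i.
  case: (ft i) => -[fH fT].
  - exists (0, 0); split=> //=; rewrite subr0; first exact: Or31.
    by move/eqP; rewrite eq_sym pnatr_eq0 muln_eq0 !gtn_eqF.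
  - exists (0, #|H i|%:R); split=> //=; rewrite sub0r cardH; first exact: Or32.
    have m0 : (0 : K) < (m i)%:R by rewrite ltr0n.
    have w0 : (0 : K) <= (w i)%:R by rewrite ler0n.
    by move=> mw; move: w0; rewrite -mw oppr_ge0 leNgt m0.
  exists (#|T i|%:R, #|H i|%:R); split=> //=.
  by rewrite cardT cardH natrD addrAC subrr add0r; apply: Or33.
exists (fun i => (p i).1 - (p i).2); split.
- apply: (shift_eigen_uniq fN0 (fD _ _ gU)).
  by apply: shift_eigen_units => i; case: (pP i).
- by move=> i; case: (pP i).
(* If every factor were [w i], then [f] would have eigenvalue |R| for the sum over the whole ring,
   whereas that sum is 0. *)
apply/existsP; rewrite -negb_forall; apply/negP => /forallP/= allw.
have fT : shift_eigen [set: R] #|R|%:R f.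
  rewrite card_prodring natr_prod setT_box; apply: shift_eigen_box => i.
  by case: (pP i) => fTi _ _ pT; rewrite -cardT -pT //; apply/eqP.
have := shift_eigen_uniq fN0 fT (fD _ _ gT).
move/eqP; rewrite pnatr_eq0 => /eqP R0.
by have : (0 < #|R|)%N by [apply/card_gt0P; exists 0]; rewrite R0.
Qed.

Lemma complement_eigenvalue_list (l : K) : eigenvalue (adjacency K e) l ->
  l = #|R|%:R - 1 - (nb_units R)%:R \/
  exists mu : 'I_n.+1 -> K,
    [/\ l = -1 - \prod_i mu i,
        forall i, [\/ mu i = 0, mu i = - (m i)%:R | mu i = (w i)%:R]
      & exists i, mu i != (w i)%:R].
Proof.
case/complement_eigenvalue => [|[g gN0 [gT gU]]]; [by left|right].
have [mu [lE mu3 mun]] := unit_eigen_list gN0 gT gU.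
by exists mu; split=> //; rewrite -lE; ring.
Qed.

(** The eigenvector is a product of functions of one coordinate. For i in [S] the function is q_i -
    1 on M_i and -1 elsewhere: it is M_i-invariant with sum zero. Elsewhere it is 1. As [S] is
    nonempty, the total sum vanishes. *)
Lemma complement_eigenvalue_set (S : {set 'I_n.+1}) : S != set0 ->
  eigenvalue (adjacency K e)
    (-1 - \prod_i (if i \in S then - (m i)%:R else (w i)%:R)).
Proof.
move=> /set0Pn[i0 i0S].
pose phi i (z : R_ i) : K :=
  if i \in S then (if z \in M i then (b i)%:R else -1) else 1.
pose g (x : R) : K := \prod_i phi i (x i).
have gE i (x : R) z : g (x + prod_inj z) =
    phi i (x i + z) * \prod_(j | j != i) phi j (x j).
  rewrite /g (bigD1 i) //= prod_addE prod_inj_in; congr (_ * _).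
  apply: eq_bigr => j ji; rewrite prod_addE prod_inj_out ?addr0 //.
  by rewrite eq_sym.
have gE0 i (x : R) : g x = phi i (x i) * \prod_(j | j != i) phi j (x j).
  by rewrite /g (bigD1 i).
have gH i : shift_eigen (H i) (m i)%:R g.
  move=> x; rewrite /shift_sum big_imset /=; last first.
    by move=> ? ? _ _; apply: prod_inj_inj.
  rewrite (eq_bigr (fun=> g x)) ?sumr_const ?mulr_natl // => z zM.
  rewrite gE (gE0 i); congr (_ * _); rewrite /phi.
  by rewrite (ideal_translation_stable (factor_ideal i)).
have gT i : shift_eigen (T i) (if i \in S then 0 else (m i + w i)%:R) g.
  move=> x; rewrite /shift_sum big_imset /=; last first.
    by move=> ? ? _ _; apply: prod_inj_inj.
  under eq_bigr => z _ do rewrite gE.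
  rewrite -mulr_suml (gE0 i) mulrA; congr (_ * _).
  have -> : \sum_(z in [set: R_ i]) phi i (x i + z) = \sum_z phi i z.
    rewrite [RHS](reindex_inj (addrI (x i))) /=.
    by apply: eq_bigl => z; rewrite inE.
  rewrite /phi; case: ifP => _.
    rewrite (bigID (mem (M i))) /= mul0r.
    rewrite (eq_bigr (fun=> (b i)%:R)); last by move=> z ->.
    rewrite [X in _ + X](eq_bigr (fun=> -1)); last by move=> z /negPf ->.
    rewrite !sumr_const -mulr_natr mulNrn.
    have -> : #|[predC M i]| = w i.
      by apply: (@addnI (m i)); rewrite cardC card_factor.
    by rewrite natrM; ring.
  by rewrite mulr1 sumr_const card_factor.
apply: (@complement_eigenvalue_intro _ _ g).
- exists 0; apply/prodf_neq0 => i _; rewrite /phi ffunE.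
  case: (factor_ideal i) => -> _ _; case: ifP => _; rewrite ?oner_eq0 //.
  by rewrite pnatr_eq0 -lt0n residue_pred_gt0.
- have := shift_eigen_box gT; rewrite -setT_box (bigD1 i0) //= i0S mul0r.
  by [].
have -> : \prod_i (if i \in S then - (m i)%:R else (w i)%:R) =
    \prod_i ((if i \in S then 0 else (m i + w i)%:R) - (m i)%:R) :> K.
  apply: eq_bigr => i _; case: ifP => _; first by rewrite sub0r.
  by rewrite natrD addrAC subrr add0r.
exact: shift_eigen_units.
Qed.

End ProductOfLocalRings.

(** * Bounds on the products of the mu_i *)

Section EigenvalueBounds.
Variables (K : realFieldType) (I : finType) (m b : I -> nat).
Hypothesis b_gt0 : forall i, (0 < b i)%N.
Local Notation w i := (m i * b i)%N.
Variable mu : I -> K.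
Hypothesis mu3 : forall i, [\/ mu i = 0, mu i = - (m i)%:R | mu i = (w i)%:R].

(** Each index where [mu i] differs from [w i] has [mu i] of absolute value at most [m i], so it
    loses a factor [b i]. *)
Lemma prod_eigen_le :
  `|\prod_i mu i| * (\prod_(i | mu i != (w i)%:R) b i)%N%:R
    <= (\prod_i w i)%N%:R.
Proof.
rewrite normr_prod !natr_prod [X in _ * X]big_mkcond -big_split /=.
apply: ler_prod => i _; apply/andP; split.
  by rewrite mulr_ge0 //; case: ifP.
have m0 : (0 : K) <= (m i)%:R by rewrite ler0n.
have b0 : (0 : K) <= (b i)%:R by rewrite ler0n.
case: ifP => [muw|/negbFE/eqP ->]; last by rewrite mulr1 normr_nat.
case: (mu3 i) muw => ->; last by rewrite eqxx.
  by rewrite normr0 mul0r ler0n.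
by rewrite normrN normr_nat natrM.
Qed.

Lemma prod_eigen_le_all : `|\prod_i mu i| <= (\prod_i w i)%N%:R.
Proof.
apply: le_trans prod_eigen_le; rewrite ler_peMr ?normr_ge0 // ler1n.
by apply: prodn_gt0.
Qed.

Lemma prod_eigen_le_one i0 : (forall i, (b i0 <= b i)%N) ->
  (exists i, mu i != (w i)%:R) ->
  `|\prod_i mu i| <= (m i0 * \prod_(i | i != i0) w i)%N%:R.
Proof.
move=> bmin [j muj]; have b0 : (0 : K) < (b i0)%:R by rewrite ltr0n.
rewrite -(ler_pM2r b0) -natrM.
have -> : (m i0 * \prod_(i | i != i0) w i * b i0 = \prod_i w i)%N.
  by rewrite [RHS](bigD1 i0) //= mulnAC.
apply: le_trans prod_eigen_le; apply: ler_wpM2l; first exact: normr_ge0.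
rewrite ler_nat (bigD1 j) //=; apply: leq_trans (bmin j) _.
by rewrite leq_pmulr //; apply: prodn_gt0.
Qed.

(* A positive product has at least two factors of the form -m i. *)
Lemma prod_eigen_le_pos i0 : (forall i, (b i0 <= b i)%N) ->
  (forall i, i != i0 -> (2 <= b i)%N) ->
  (exists i, mu i != (w i)%:R) -> 0 < \prod_i mu i ->
  2 * \prod_i mu i <= (m i0 * \prod_(i | i != i0) w i)%N%:R.
Proof.
move=> bmin b2 [j muj] mupos; have b0 : (0 : K) < (b i0)%:R by rewrite ltr0n.
have [k kj muk] : exists2 k, k != j & mu k != (w k)%:R.
  apply/exists_inP; rewrite -negb_forall_in; apply/negP => /forall_inP allw.
  move: mupos; apply/negP; rewrite -leNgt (bigD1 j) //=.
  apply: mulr_le0_ge0; last by apply: prodr_ge0 => i /allw/eqP ->.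
  case: (mu3 j) muj => ->; rewrite ?lexx ?oppr_le0 ?ler0n //.
  by rewrite eqxx.
rewrite -(ler_pM2r b0) -natrM.
have -> : (m i0 * \prod_(i | i != i0) w i * b i0 = \prod_i w i)%N.
  by rewrite [RHS](bigD1 i0) //= mulnAC.
apply: le_trans prod_eigen_le.
rewrite (gtr0_norm mupos) mulrAC mulrC; apply: ler_wpM2l; first exact: ltW.
rewrite -natrM ler_nat (bigD1 j) //= (bigD1 k) ?kj ?muk //= mulnA.
apply: leq_trans (_ : b j * b k <= _)%N; last first.
  by rewrite leq_pmulr //; apply: prodn_gt0.
(* At most one of the distinct [j] and [k] is [i0]; the other one contributes the factor 2. *)
have [k0|k0] := eqVneq k i0; last first.
  by rewrite mulnC; apply: leq_mul => //; apply: b2.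
rewrite -k0; apply: leq_mul => //; apply: b2.
by rewrite -k0 eq_sym.
Qed.

End EigenvalueBounds.

Lemma ler_sqrt_sqr (K : realType) (x y : K) : 0 <= x -> 0 <= y ->
  (x <= 2 * Num.sqrt y) = (x ^+ 2 <= 4 * y).
Proof.
move=> x0 y0; rewrite -ler_sqr ?nnegrE ?mulr_ge0 ?sqrtr_ge0 //.
by rewrite exprMn sqr_sqrtr //; have -> : 2 ^+ 2 = 4 :> K by ring.
Qed.

Lemma leq_prodn (I : finType) (P : pred I) (f g : I -> nat) :
  (forall i, P i -> (f i <= g i)%N) ->
  (\prod_(i | P i) f i <= \prod_(i | P i) g i)%N.
Proof. by move=> fg; elim/big_ind2: _ => // *; apply: leq_mul. Qed.

(** * The Ramanujan property as a single inequality *)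

Section RamanujanCriteria.
Variables (K : realType) (n : nat) (R_ : 'I_n.+1 -> finComUnitRingType).
Variables (M : forall i, {set R_ i}).
Hypothesis M_local : forall i, local_ring_with (M i).
Local Notation R := (prodring R_).
Local Notation e := (complement_graph (unitary_cayley R)).
Local Notation m i := #|M i|.
Local Notation b i := (residue_card (M i)).-1.
Local Notation w i := (#|M i| * (residue_card (M i)).-1)%N.
Local Notation N := (#|R|%:R : K).
Local Notation u := ((nb_units R)%:R : K).
Variables i0 i1 : 'I_n.+1.
Hypothesis i01 : i1 != i0.

Let w_gt0 i : (0 < w i)%N.
Proof. by rewrite muln_gt0 card_factor_ideal_gt0 // residue_pred_gt0. Qed.

Lemma nb_units_gt0 : (0 < nb_units R)%N.
Proof. by rewrite (nb_units_prod M_local); apply: prodn_gt0. Qed.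

Lemma degree_natr : (nb_units R < #|R|)%N ->
  (#|R| - 1 - nb_units R)%N%:R = N - 1 - u.
Proof. by move=> uN; rewrite -subnDA natrB; [rewrite natrD; ring|lia]. Qed.

Lemma ramanujan_complementP : (nb_units R < #|R|)%N ->
  ramanujan K e <-> forall l, eigenvalue (adjacency K e) l ->
    l != N - 1 - u -> l != - (N - 1 - u) ->
    `|l| <= 2 * Num.sqrt (N - 2 - u).
Proof.
move=> uN; have rE := degree_natr uN.
have -> : N - 2 - u = (#|R| - 1 - nb_units R)%N%:R - 1 by rewrite rE; ring.
rewrite -rE; split; last first.
  move=> Hl; exists (#|R| - 1 - nb_units R)%N => //.
  exact: complement_regular.
case=> r rreg.
rewrite -(regular_graph_uniq (0 : R) (@complement_regular R) rreg).
exact.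
Qed.

(** In each of the two factors with residue field of order 2, exactly half of the elements are
    units. *)
Lemma card_ge_two_residue_two : b i0 = 1%N -> b i1 = 1%N ->
  (4 * nb_units R <= #|R|)%N.
Proof.
move=> b0 b1; rewrite (nb_units_prod M_local) (card_prodring M_local).
rewrite (bigD1 i0) //= (bigD1 i1) //= [leqRHS](bigD1 i0) //=.
rewrite [X in (_ <= _ * X)%N](bigD1 i1) //= b0 b1 !muln1.
set X := (\prod_(i | _) _)%N; set Y := (\prod_(i | _) _)%N.
have XY : (X <= Y)%N by apply: leq_prodn => i _; rewrite leq_addl.
have -> : (4 * (m i0 * (m i1 * X)) = (m i0 + m i0) * ((m i1 + m i1) * X))%N.
  by ring.
by rewrite !leq_mul.
Qed.

(** Choosing -m_i at [i0] and [i1] only, the signs cancel and the product is [u]. This gives the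
    eigenvalue -1 - u, and apart from the degree none is larger in absolute value. *)
Lemma ramanujan_two_residue_two : b i0 = 1%N -> b i1 = 1%N ->
  ramanujan K e <-> 1 + u <= 2 * Num.sqrt (N - 2 - u).
Proof.
move=> b0 b1; have uN := card_ge_two_residue_two b0 b1.
have u0 := nb_units_gt0.
have uNK : 4 * u <= N by rewrite -natrM ler_nat.
have u0K : 1 <= u by rewrite ler1n.
rewrite ramanujan_complementP ?(leq_trans _ uN) //; last by lia.
split=> [ram|le_u l /(complement_eigenvalue_list M_local)[->|]]; last first.
- move=> [mu [-> mu3 _]] _ _; apply: le_trans le_u.
  have := prod_eigen_le_all (residue_pred_gt0 M_local) mu3.
  rewrite -(nb_units_prod M_local) -opprD normrN => le_mu.
  by apply: le_trans (ler_normD _ _) _; rewrite normr1 lerD2l.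
- by rewrite eqxx.
pose S := [set i0; i1].
have S0 : S != set0 by apply/set0Pn; exists i0; rewrite !inE eqxx.
have := complement_eigenvalue_set K M_local S0.
have -> : \prod_i (if i \in S then - (m i)%:R else (w i)%:R) = u.
  rewrite (nb_units_prod M_local) natr_prod (bigD1 i0) //= (bigD1 i1) //=.
  rewrite [RHS](bigD1 i0) //= [X in _ = _ * X](bigD1 i1) //=.
  rewrite !inE !eqxx orbT b0 b1 !muln1 mulrA mulrNN -mulrA.
  congr (_ * (_ * _)); apply: eq_bigr => i /andP[ii0 ii1].
  by rewrite !inE (negPf ii0) (negPf ii1).
move=> /ram; have [|_] := eqVneq (-1 - u) (N - 1 - u); first by lra.
have [Nu _|_] := eqVneq (-1 - u) (- (N - 1 - u)); last first.
  move=> /(_ isT isT); rewrite -opprD normrN ger0_norm //; lra.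
(* Here -1 - u is minus the degree, so the Ramanujan condition says nothing. Then N = 2u + 2, which
   with 4u <= N leaves one case, where the inequality is an equality. *)
have u1 : u = 1 by lra.
have N4 : N = 4 by lra.
rewrite u1 N4; have -> : 4 - 2 - 1 = 1 :> K by ring.
by rewrite sqrtr1; lra.
Qed.

(** The absolute value of the product with -m_i at [i0] alone, that is, the number of units divided
    by [b i0]. *)
Let v := (m i0 * \prod_(i | i != i0) w i)%N.

Lemma nb_units_mul : nb_units R = (b i0 * v)%N.
Proof.
by rewrite (nb_units_prod M_local) (bigD1 i0) //= /v mulnA [(b i0 * _)%N]mulnC.
Qed.

(** Away from [i0] the product ring has more elements than units, because M_i contains 0 at [i1].
    The bound puts the degree above [v] and keeps the radicands nonnegative. *)
Lemma card_ge_add : (nb_units R + v + b i0 + 1 <= #|R|)%N.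
Proof.
rewrite nb_units_mul (card_prodring M_local) (bigD1 i0) //= /v.
set X := (\prod_(i | _) _)%N; set Y := (\prod_(i | _) _)%N.
have XY : (X < Y)%N.
  rewrite /X /Y (bigD1 i1) //= [ltnRHS](bigD1 i1) //=.
  have lt_mul x y a z : (0 < x -> x <= y -> 0 < a -> z * x < (a + z) * y)%N.
    by nia.
  apply: lt_mul; [exact: prodn_gt0| |exact: card_factor_ideal_gt0].
  by apply: leq_prodn => i _; rewrite leq_addl.
have m0 := card_factor_ideal_gt0 M_local i0.
have mb : (b i0 <= m i0 * b i0)%N by rewrite leq_pmull.
apply: leq_trans (leq_mul (leqnn _) XY).
have -> : ((m i0 + w i0) * X.+1 = b i0 * (m i0 * X) + m i0 * X + w i0 + m i0)%N.
  by rewrite mulnS; ring.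
by rewrite leq_add // leq_add2l.
Qed.

Lemma small_unit_factor_ge2 :
  (forall i, i != i0 -> (2 <= b i)%N) -> (2 <= v)%N.
Proof.
move=> b2; rewrite /v (bigD1 i1) //= mulnCA.
rewrite -mulnA mulnCA; apply: leq_trans (b2 i1 i01) _.
by rewrite leq_pmulr // !muln_gt0 !card_factor_ideal_gt0 // prodn_gt0.
Qed.

(** The extremal eigenvalue is v - 1. Negative products are at least -v, and positive ones at most v
    / 2. *)
Lemma ramanujan_one_min : (forall i, (b i0 <= b i)%N) ->
  (forall i, i != i0 -> (2 <= b i)%N) ->
  ramanujan K e <-> v%:R - 1 <= 2 * Num.sqrt (N - 2 - u).
Proof.
move=> bmin b2; have Nge := card_ge_add.
have v2 := small_unit_factor_ge2 b2.
have b0 := residue_pred_gt0 M_local i0.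
have v2K : 2 <= v%:R :> K by rewrite (ler_nat K 2).
have NgeK : u + v%:R + (b i0)%:R + 1 <= N.
  by move: Nge; rewrite -(ler_nat K) !natrD.
have b0K : 1 <= (b i0)%:R :> K by rewrite ler1n.
rewrite ramanujan_complementP //; last by lia.
split=> [ram|le_v l /(complement_eigenvalue_list M_local)[->|]]; last first.
- move=> [mu [-> mu3 mun]] _ _.
  have le1 := prod_eigen_le_one (residue_pred_gt0 M_local) mu3 bmin mun.
  have le2 := prod_eigen_le_pos (residue_pred_gt0 M_local) mu3 bmin b2 mun.
  move: (\prod_i mu i) le1 le2 => c.
  rewrite -/v ler_norml => /andP[cv1 cv2] cpos.
  rewrite -opprD normrN ler_norml; have [c0|c0] := ltP 0 c; last first.
    by apply/andP; split; lra.
  have {}cpos := cpos c0; apply/andP; split; first by lra.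
  (* For v >= 4, 1 + v / 2 is at most v - 1. For smaller v the Ramanujan bound is met directly,
     since N - 2 - u >= v. *)
  have [v4|v4] := leP 4 (v%:R : K); first by lra.
  by rewrite ler_sqrt_sqr; [nra|lra|lra].
- by rewrite eqxx.
have S0 : [set i0] != set0 by apply/set0Pn; exists i0; rewrite !inE.
have := complement_eigenvalue_set K M_local S0.
have -> : \prod_i (if i \in [set i0] then - (m i)%:R else (w i)%:R) =
    - v%:R :> K.
  rewrite (bigD1 i0) //= inE eqxx mulNr natrM natr_prod; congr (- (_ * _)).
  by apply: eq_bigr => i /negPf ii0; rewrite inE ii0.
(* The degree exceeds v - 1, so this eigenvalue is neither the degree nor its negative. *)
move=> /ram; have [|_] := eqVneq (-1 - - v%:R) (N - 1 - u); first by lra.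
have [|_] := eqVneq (-1 - - v%:R) (- (N - 1 - u)); first by lra.
by move=> /(_ isT isT); rewrite ger0_norm opprK; lra.
Qed.

End RamanujanCriteria.

(** * Equivalent forms of the quadratic inequalities *)

Section QuadraticBounds.
Variable K : realType.
Implicit Types a m u v N P : K.

(** Squaring gives m^2 - 2 (2P - 3) m + 9 <= 0, and the right-hand side is the larger root. The
    smaller root is at most 1, hence at most m. *)
Lemma bound_all_two m P : 1 <= m -> 4 <= P ->
  (1 + m <= 2 * Num.sqrt (P * m - 2 - m)) =
  (m <= 2 * P - 3 + 2 * Num.sqrt (P * (P - 3))).
Proof.
move=> m1 P4; rewrite ler_sqrt_sqr; [|lra|nra].
have s0 : 0 <= Num.sqrt (P * (P - 3)) by apply: sqrtr_ge0.
have s2 : Num.sqrt (P * (P - 3)) ^+ 2 = P * (P - 3).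
  by rewrite sqr_sqrtr //; nra.
move: (Num.sqrt _) s0 s2 => s s0 s2; apply/idP/idP => le_m; last first.
  have [mP|mP] := leP (2 * P - 3) m; last by nra.
  have : 0 <= (2 * s - (m - (2 * P - 3))) * (2 * s + (m - (2 * P - 3))).
    by apply: mulr_ge0; lra.
  by nra.
rewrite leNgt; apply/negP => lt_m.
have : 0 < (m - (2 * P - 3) - 2 * s) * (m - (2 * P - 3) + 2 * s).
  by apply: mulr_gt0; lra.
by nra.
Qed.

Lemma bound_two_two u N : 1 <= u -> 4 * u <= N ->
  (1 + u <= 2 * Num.sqrt (N - 2 - u)) = (u <= 2 * Num.sqrt N - 3).
Proof.
move=> u1 uN; rewrite lerBrDr !ler_sqrt_sqr; lra.
Qed.

Lemma bound_one_two u N : 2 <= u -> 2 * u + 2 <= N ->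
  (u - 1 <= 2 * Num.sqrt (N - 2 - u)) = (u <= 2 * Num.sqrt (N - 2) - 1).
Proof.
move=> u2 uN; rewrite lerBrDr !ler_sqrt_sqr; lra.
Qed.

(** Squaring and completing the square in v turns the left inequality into (v + 2a - 1)^2 <= (2a -
    1)^2 + 4N - 9. *)
Lemma bound_no_two a v N : 2 <= v -> 2 <= a -> a * v + v + a + 1 <= N ->
  (v - 1 <= 2 * Num.sqrt (N - 2 - a * v)) =
  (v <= - (2 * a - 1) + Num.sqrt ((2 * a - 1) ^+ 2 + (4 * N - 9))).
Proof.
move=> v2 a2 avN; have av : 4 <= a * v by nra.
rewrite ler_sqrt_sqr; [|lra|lra].
rewrite [X in _ = (_ <= X)]addrC lerBrDr.
rewrite -[X in _ = (X <= _)]ger0_norm; last by lra.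
rewrite -sqrtr_sqr ler_sqrt; last by have := sqr_ge0 (2 * a - 1); lra.
by apply/idP/idP; nra.
Qed.

End QuadraticBounds.

(** * The four cases, by the two smallest residue cardinalities *)

Theorem theorem4p2 (K : realType) (n : nat)
    (R_ : 'I_n.+2 -> finComUnitRingType) (M : forall i, {set R_ i})
    (hlocal : forall i, local_ring_with (M i))
    (hsorted : forall i j : 'I_n.+2,
      (i <= j)%N -> (residue_card (M i) <= residue_card (M j))%N) :
  let s := n.+2 in
  let R : finComUnitRingType := prodring R_ in
  let q i := residue_card (M i) in
  let m i := #|M i| in
  ramanujan K (complement_graph (unitary_cayley R)) <->
  [\/ (forall i, q i = 2%N) /\
      (\prod_i m i)%:R <=
        2 ^+ s.+1 - 3 + 2 * Num.sqrt (2 ^+ s * (2 ^+ s - 3)) :> K,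
      (exists t : 'I_n.+2,
         [/\ (2 <= t)%N,
             forall i : 'I_n.+2, (i < t)%N -> q i = 2%N
           & (2 < q t)%N]) /\
      (nb_units R)%:R <= 2 * Num.sqrt #|R|%:R - 3 :> K,
      [/\ q ord0 = 2%N, (2 < q (inord 1))%N
        & (nb_units R)%:R <= 2 * Num.sqrt (#|R|%:R - 2) - 1 :> K]
    | (3 <= q ord0)%N /\
      (nb_units R)%:R / ((q ord0)%:R - 1) <=
        - (2 * (q ord0)%:R - 3)
        + Num.sqrt ((2 * (q ord0)%:R - 3) ^+ 2 + (4 * #|R|%:R - 9)) :> K].
Proof.
move=> s R q m.
have q_gt1 i : (1 < q i)%N by apply: residue_card_gt1; apply: factor_ideal.
pose i1 : 'I_n.+2 := inord 1.
have i1E : i1 = 1%N :> nat by rewrite inordK.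
have i10 : i1 != ord0 by rewrite -val_eqE /= i1E.
have q0_min i : (q ord0 <= q i)%N by apply: hsorted.
have q1_min i : i != ord0 -> (q i1 <= q i)%N.
  by rewrite -val_eqE -lt0n => i_gt0; apply: hsorted; rewrite i1E.
have u_gt0 : 1 <= (nb_units R)%:R :> K by rewrite ler1n (nb_units_gt0 hlocal).
(* By sortedness this decides whether at least two residue fields have order 2, and so separates (a)
   and (b) from (c) and (d). *)
have [q1_2|q1_gt2] := leqP (q i1) 2.
  have q1E : q i1 = 2%N by apply/eqP; rewrite eqn_leq q1_2 q_gt1.
  have q0E : q ord0 = 2%N.
    by apply/eqP; rewrite eqn_leq q_gt1 andbT -q1E q0_min.
  have b0E : (q ord0).-1 = 1%N by rewrite q0E.
  have b1E : (q i1).-1 = 1%N by rewrite q1E.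
  have le_4u := card_ge_two_residue_two hlocal i10 b0E b1E.
  rewrite (ramanujan_two_residue_two K hlocal i10 b0E b1E) -/R.
  have {}le_4u : 4 * (nb_units R)%:R <= #|R|%:R :> K by rewrite -natrM ler_nat.
  have [/forallP all2|] := boolP [forall i, q i == 2%N].
    have {}all2 i : q i = 2%N by apply/eqP.
    have uE : nb_units R = (\prod_i m i)%N.
      rewrite (nb_units_prod hlocal); apply: eq_bigr => i _.
      by rewrite -/(q i) all2 muln1.
    have NE : #|R| = (2 ^ s * \prod_i m i)%N.
      rewrite (card_prodring hlocal) -[s]card_ord -prod_nat_const -big_split /=.
      by apply: eq_bigr => i _; rewrite -/(q i) all2 muln1 mul2n addnn.
    have P4 : 4 <= 2 ^+ s :> K by rewrite -natrX (ler_nat K 4) (@leq_exp2l 2 2).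
    have boundE := bound_all_two (K := K) _ P4.
    rewrite NE natrM natrX uE boundE -?uE // -exprS.
    split=> [le_m|[[_ //]|[[t [_ _]]]|[_ //]|[]]]; first exact: Or41.
    - by rewrite all2.
    - by rewrite q0E.
  rewrite negb_forall => /existsP[t0 qt0].
  (* The witness for (b) is the first index with [q t] not 2; as indices start at 0, [t] is also the
     number of factors with residue cardinality 2. *)
  have [t qt t_min] := @arg_minnP _ t0 (fun t => q t != 2%N) val qt0.
  have lt_t (i : 'I_n.+2) : (i < t)%N -> q i = 2%N.
    move=> it; apply/eqP; apply: contraLR it => qi; rewrite -leqNgt.
    exact: t_min.
  have t_gt1 : (2 <= t)%N.
    rewrite ltnNge; apply: contra qt => t1; apply/eqP.
    apply/eqP; rewrite eqn_leq q_gt1 andbT -q1E; apply: hsorted.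
    by rewrite i1E.
  rewrite (bound_two_two u_gt0 le_4u).
  split=> [le_u|[[all2]|[]|[_ //]|[]]] //.
  - apply: Or42; split=> //; exists t; split=> //.
    by rewrite ltn_neqAle eq_sym qt q_gt1.
  - by rewrite all2 eqxx in qt.
  - by rewrite q0E.
have b0_min i : ((q ord0).-1 <= (q i).-1)%N by have := q0_min i; lia.
have b_gt1 i : i != ord0 -> (2 <= (q i).-1)%N.
  by move=> /q1_min; move: q1_gt2; lia.
have uE := nb_units_mul hlocal ord0.
have leN := card_ge_add hlocal i10.
have v2 := small_unit_factor_ge2 hlocal i10 b_gt1.
rewrite (ramanujan_one_min K hlocal i10 b0_min b_gt1) -/R.
move: (#|M ord0| * _)%N uE leN v2 => v; rewrite -/R -/(q ord0) => uE leN v2.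
have v2K : 2 <= v%:R :> K by rewrite (ler_nat K 2).
have [q0_2|q0_gt2] := leqP (q ord0) 2.
  have q0E : q ord0 = 2%N by apply/eqP; rewrite eqn_leq q0_2 q_gt1.
  (* With [q ord0] equal to 2, [v] is the number of units itself. *)
  rewrite q0E mul1n in uE leN; rewrite -uE in v2K leN *.
  have {}leN : 2 * (nb_units R)%:R + 2 <= #|R|%:R :> K.
    by move: leN; rewrite -(ler_nat K) !natrD /=; lra.
  rewrite (bound_one_two v2K leN).
  split=> [le_u|[[all2]|[[t [t2 lt_t _]]]|[_ _]|[]]] //.
  - exact: Or43.
  - by move: q1_gt2; rewrite all2.
  - by move: q1_gt2; rewrite lt_t // i1E.
have qE : (q ord0)%:R = (q ord0).-1%:R + 1 :> K.
  by rewrite natr1 prednK // ltnW.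
have a2 : 2 <= (q ord0).-1%:R :> K by rewrite (ler_nat K 2); lia.
have {}leN : (q ord0).-1%:R * v%:R + v%:R + (q ord0).-1%:R + 1 <= #|R|%:R :> K.
  by move: leN; rewrite uE -(ler_nat K) !natrD natrM.
(* Here a is [q ord0] minus 1, so 2a - 1 is the constant 2q - 3 of (d), and [v] is the quotient on
   its left-hand side. *)
have boundE := bound_no_two v2K a2 leN.
have -> : (nb_units R)%:R / ((q ord0)%:R - 1) = v%:R :> K.
  have a0 : (q ord0).-1%:R != 0 :> K by rewrite gt_eqF //; lra.
  by rewrite uE natrM qE addrK mulrAC divff // mul1r.
have -> : 2 * (q ord0)%:R - 3 = 2 * (q ord0).-1%:R - 1 :> K by rewrite qE; ring.
rewrite -boundE uE natrM.
split=> [le_v|[[all2]|[[t [t2 lt_t _]]]|[q0E]|[]]] //.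
- exact: Or44.
- by move: q1_gt2; rewrite all2.
- by move: q1_gt2; rewrite lt_t // i1E.
- by move: q0_gt2; rewrite q0E.
Qed.
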